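(* Let $n\ge2$, $B\in\mathsf{SL}(n)$, $C\in\mathfrak{sl}(n)$, and let $A(t)=Be^{tC}$. Then $A(t)$ is a geodesic of $\mathsf{SL}(n)$ with the HS metric if and only if exactly one of the following holds: (i) $C^2=0$; or (ii) $n$ is even, $C\in\mathfrak{so}(n)$, and $C^2=\kappa(B^TB)^{-1}$ for some real $\kappa<0$.
   Context: $\mathcal{M}(n)$ is the space of real $n\times n$ matrices with the Hilbert-Schmidt inner product $\langle A,B\rangle=\operatorname{tr}(AB^T)$. The HS metric on $\mathsf{SL}(n)=\{A\in\mathcal{M}(n):\det A=1\}$ is the Riemannian metric induced on it as a submanifold of the Euclidean space $\mathcal{M}(n)$. A curve $A(t)$ in $\mathsf{SL}(n)$ is a geodesic iff \[A''=\frac{\operatorname{tr}(A'A^{-1}A'A^{-1})}{\operatorname{tr}(A^{-1}A^{-T})}A^{-T}.\] $\mathfrak{sl}(n)$ is the set of trace-free matrices and $\mathfrak{so}(n)$ the set of antisymmetric matrices in $\mathcal{M}(n)$. *)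

(* Defs.v *)
From HB Require Import structures.
From mathcomp Require Import all_boot all_order all_algebra.
From mathcomp Require Import all_classical all_reals all_analysis.

Set Implicit Arguments.
Unset Strict Implicit.
Unset Printing Implicit Defensive.

Import Order.TTheory GRing.Theory Num.Theory.
Import numFieldNormedType.Exports.

Local Open Scope classical_set_scope.
Local Open Scope ring_scope.

Definition SL (R : realType) (n : nat) : set 'M[R]_n := [set A | \det A = 1].

Definition sl (R : realType) (n : nat) : set 'M[R]_n := [set A | \tr A = 0].

Definition so (R : realType) (n : nat) : set 'M[R]_n := [set A | A^T = - A].

Definition hs_inner (R : realType) (n : nat) (A B : 'M[R]_n) : R :=
  \tr (A *m B^T).

(* The normed structure of 'M[R]_n is the entrywise sup norm; limits and
   derivatives are the same as for the Hilbert-Schmidt norm. *)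
Definition expmx (R : realType) (n : nat) (M : 'M[R]_n) : 'M[R]_n :=
  limn (series (fun k : nat => (k`!%:R)^-1 *: (M ^+ k))).

Definition smooth_SL_curve (R : realType) (n : nat) (A : R -> 'M[R]_n) : Prop :=
  (forall t : R, SL (A t)) /\
  (forall (k : nat) (t : R), derivable (A^`(k))%classic t 1).

(* T_P SL(n), as the set of velocities at P of smooth curves in SL(n). *)
Definition SL_tangent (R : realType) (n : nat) (P : 'M[R]_n) : set 'M[R]_n :=
  [set X | exists g : R -> 'M[R]_n,
     [/\ smooth_SL_curve g, g 0 = P & (g^`())%classic 0 = X]].

(* For the metric induced on SL(n) by the Euclidean space ('M[R]_n, hs_inner),
   the covariant derivative of A' along A is the orthogonal projection of A''
   onto the tangent space at A t. It vanishes exactly when A'' is normal to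
   SL(n). *)
Definition SL_geodesic (R : realType) (n : nat) (A : R -> 'M[R]_n) : Prop :=
  smooth_SL_curve A /\
  (forall (t : R) (X : 'M[R]_n),
     SL_tangent (A t) X -> hs_inner ((A^`(2))%classic t) X = 0).

Definition exactly_one (P Q : Prop) : Prop := (P /\ ~ Q) \/ (~ P /\ Q).

(* Main.v *)
Require Import Defs.
From HB Require Import structures.
From mathcomp Require Import all_boot all_order all_algebra.
From mathcomp Require Import perm.
From mathcomp Require Import all_classical all_reals all_analysis.

Import Order.TTheory GRing.Theory Num.Theory.
Import numFieldNormedType.Exports.

Local Open Scope classical_set_scope.
Local Open Scope ring_scope.

(** Jacobi's formula identifies the tangent space of SL(n) at A with the
    matrices A Y, tr Y = 0, so that a curve A is a geodesic iff A^T A'' is a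
    scalar matrix at all times.  For A = B E with E = e^{tC}, this matrix is
    E^T (B^T B C^2) E.  At t = 0 it gives B^T B C^2 = k I.  If k = 0 then
    C^2 = 0.  Otherwise E^T E is a multiple of I at all times, and its
    derivative C^T + C at t = 0 is a multiple of I with trace 0, so C is
    skew; then C C^T = - k (B^T B)^-1 forces k < 0, and n is even because C is
    invertible.  Conversely, if C is skew then E is orthogonal, and
    E^T (k I) E = k I. *)

(** * Entrywise calculus of matrix-valued functions, up to Jacobi's formula *)

Lemma cvg_mx_entries (R : realType) (m n : nat) (u : nat -> 'M[R]_(m, n))
    (L : 'M[R]_(m, n)) :
  (forall i j, (fun k => u k i j) @ \oo --> L i j) -> u @ \oo --> L.
Proof.
move=> uL; apply/cvgrPdist_le => /= e e0.
near=> k.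
rewrite /Num.Def.normr/= mx_normrE (bigmax_le _ (ltW e0))//= => i _.
rewrite !mxE/=.
move: i; near: k; apply: filter_forall => /= i.
exact: ((cvgrPdist_le _ _).1 (uL i.1 i.2)).
Unshelve. all: by end_near. Qed.

Lemma is_derive_mxP (R : realType) (m n : nat) (M : R -> 'M[R]_(m, n))
    (t : R) (D : 'M[R]_(m, n)) :
  is_derive t 1 M D <-> forall i j, is_derive t 1 (fun x => M x i j) (D i j).
Proof.
split=> [[dM DM] i j|dM].
- have /derivable_mxP dMij := dM.
  by split=> //; rewrite -DM derive_mx// mxE.
- have dM' : derivable M t 1 by apply/derivable_mxP => i j; have [] := dM i j.
  split=> //; rewrite derive_mx//; apply/matrixP => i j; rewrite mxE.
  by have [] := dM i j.
Qed.

Lemma is_derive_bigsum (R : realType) (I : Type) (r : seq I)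
    (f : I -> R -> R) (f' : I -> R) (t : R) :
  (forall i, is_derive t 1 (f i) (f' i)) ->
  is_derive t 1 (fun x => \sum_(i <- r) f i x) (\sum_(i <- r) f' i).
Proof.
move=> df; elim: r => [|i r IHr].
  rewrite big_nil (_ : (fun _ => _) = cst 0); first exact: is_derive_cst.
  by apply/funext => x; rewrite big_nil.
rewrite big_cons (_ : (fun _ => _) = f i + (fun x => \sum_(i <- r) f i x)).
  exact: is_deriveD.
by apply/funext => x; rewrite big_cons.
Qed.

(** Leibniz rule, by splitting off the first factor. The conditional inside the product mirrors a
    determinant whose row [i] has been replaced, which is how [is_derive_det] uses it. *)
Lemma is_derive_prod (R : realType) (n : nat) (f : 'I_n -> R -> R)
    (f' : 'I_n -> R) (t : R) :
  (forall i, is_derive t 1 (f i) (f' i)) ->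
  is_derive t 1 (fun x => \prod_(j < n) f j x)
    (\sum_(i < n) \prod_(j < n) (if j == i then f' j else f j t)).
Proof.
elim: n f f' => [|n IHn] f f' df.
  rewrite big_ord0 (_ : (fun _ => _) = cst 1); first exact: is_derive_cst.
  by apply/funext => x; rewrite big_ord0.
rewrite (_ : (fun _ => _) = f ord0 * (fun x => \prod_(j < n) f (lift ord0 j) x)).
  have dtl := IHn (fun i => f (lift ord0 i)) (fun i => f' (lift ord0 i))
    (fun i => df (lift ord0 i)).
  apply: is_derive_eq.
  rewrite [RHS]big_ord_recl addrC big_ord_recl eqxx; congr (_ + _).
    by rewrite /GRing.scale/= mulrC; congr (_ * _); apply: eq_bigr.
  rewrite /GRing.scale/= mulr_sumr; apply: eq_bigr => i _.
  by rewrite big_ord_recl; congr (_ * _); apply: eq_bigr.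
by apply/funext => x; rewrite big_ord_recl.
Qed.

Lemma is_derive_mulmx (R : realType) (m n p : nat) (M : R -> 'M[R]_(m, n))
    (N : R -> 'M[R]_(n, p)) (t : R) (M' : 'M[R]_(m, n)) (N' : 'M[R]_(n, p)) :
  is_derive t 1 M M' -> is_derive t 1 N N' ->
  is_derive t 1 (fun x => M x *m N x) (M' *m N t + M t *m N').
Proof.
move=> /is_derive_mxP dM /is_derive_mxP dN; apply/is_derive_mxP => i j.
rewrite (_ : (fun _ => _) = fun x => \sum_k M x i k * N x k j); last first.
  by apply/funext => x; rewrite mxE.
rewrite !mxE -big_split/=; apply: is_derive_bigsum => k.
have := is_deriveM (dM i k) (dN k j).
by rewrite /GRing.scale/= addrC [_ * M' i k]mulrC.
Qed.

Lemma is_derive_trmx (R : realType) (m n : nat) (M : R -> 'M[R]_(m, n)) (t : R)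
    (M' : 'M[R]_(m, n)) :
  is_derive t 1 M M' -> is_derive t 1 (fun x => (M x)^T) M'^T.
Proof.
move=> /is_derive_mxP dM; apply/is_derive_mxP => i j; rewrite mxE.
rewrite (_ : (fun _ => _) = fun x => M x j i)//.
by apply/funext => x; rewrite mxE.
Qed.

Lemma is_derive_0_mx_cst (R : realType) (m n : nat) (M : R -> 'M[R]_(m, n))
    (s t : R) : (forall x : R, is_derive x 1 M 0) -> M s = M t.
Proof.
move=> dM; apply/matrixP => i j.
apply: (@is_derive_0_is_cst _ (fun x => M x i j)) => x.
by have /is_derive_mxP/(_ i j) := dM x; rewrite mxE.
Qed.

(** Jacobi's formula. Differentiating the permutation expansion row by row gives the determinants of
    the matrices [N i], in which row [i] of [M t] is replaced by that of [M']. Cofactor expansion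
    along this row yields the [i]-th diagonal entry of [M' *m \adj (M t)]. *)
Lemma is_derive_det (R : realType) (n : nat) (M : R -> 'M[R]_n) (t : R)
    (M' : 'M[R]_n) :
  is_derive t 1 M M' ->
  is_derive t 1 (fun x => \det (M x)) (\tr (M' *m \adj (M t))).
Proof.
move=> /is_derive_mxP dM.
pose N i := \matrix_(j, k) (if j == i then M' j k else M t j k).
have -> : \tr (M' *m \adj (M t)) = \sum_i \det (N i).
  apply: eq_bigr => i _; rewrite (expand_det_row _ i) mxE.
  apply: eq_bigr => k _; rewrite !mxE eqxx; congr (_ * _).
  rewrite /cofactor; congr (_ * \det _); apply/matrixP => a b.
  by rewrite !mxE eq_sym (negbTE (neq_lift _ _)).
under eq_bigr do rewrite /determinant; rewrite exchange_big/=.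
apply: is_derive_bigsum => /= s; rewrite -mulr_sumr.
under eq_bigr do under eq_bigr do rewrite mxE.
have dP := @is_derive_prod R n (fun i x => M x i (s i)) _ t (fun i => dM i (s i)).
exact: (is_deriveZ ((-1) ^+ s) dP).
Qed.

(** * The matrix exponential, its entries as power series, and its derivative *)

Lemma cvg_pseries_fact (R : realType) (a : R^nat) (L K : R) (x : R) :
  (forall k, `|a k| <= L * K ^+ k) ->
  cvgn (pseries (fun k => (k`!%:R)^-1 * a k) x).
Proof.
move=> aK; apply: normed_cvg.
(* The dominating series is that of [L] times the exponential of [K * |x|]. *)
have cvLK : cvgn (series (L *: exp_coeff (K * `|x|))).
  by apply: is_cvg_seriesZ; exact: is_cvg_series_exp_coeff.
have le_uv k : `|(k`!%:R)^-1 * a k * x ^+ k| <= L * ((K * `|x|) ^+ k / k`!%:R).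
  rewrite !normrM normrX ger0_norm ?invr_ge0//.
  rewrite mulrA [leRHS]mulrC -mulrA ler_wpM2l ?invr_ge0// exprMn mulrA.
  by rewrite ler_wpM2r// exprn_ge0.
apply: (series_le_cvg _ _ le_uv cvLK) => k //.
by rewrite (le_trans _ (le_uv k)).
Qed.


(** With the factor 1/k! kept apart, termwise differentiation is the shift of [a]. The shift
    preserves a geometric bound, replacing [L] by [L * K], so the series and its first two formal
    derivatives all converge. *)
Lemma is_derive_pseries_fact (R : realType) (a : R^nat) (L K : R) (t : R) :
  (forall k, `|a k| <= L * K ^+ k) ->
  is_derive t 1 (fun x => limn (pseries (fun k => (k`!%:R)^-1 * a k) x))
    (limn (pseries (fun k => (k`!%:R)^-1 * a k.+1) t)).
Proof.
move=> aK.
have diffsE (b : R^nat) : pseries_diffs (fun k => (k`!%:R)^-1 * b k) =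
    (fun k => (k`!%:R)^-1 * b k.+1).
  by apply/funext => k; rewrite /pseries_diffs factS natrM invfM !mulrA mulfV ?mul1r.
have shiftK (b : R^nat) (M : R) : (forall k, `|b k| <= M * K ^+ k) ->
    forall k, `|b k.+1| <= (M * K) * K ^+ k.
  by move=> bK k; rewrite -mulrA -exprS.
rewrite -diffsE.
(* The convergence is needed at a single point of modulus larger than that of [t]. *)
apply: (@pseries_snd_diffs _ _ (`|t| + 1)); rewrite ?diffsE.
- exact: cvg_pseries_fact aK.
- exact: cvg_pseries_fact (shiftK _ _ aK).
- exact: cvg_pseries_fact (shiftK _ _ (shiftK _ _ aK)).
- by rewrite [ltRHS]ger0_norm ?addr_ge0// ltrDl.
Qed.

(** The sum of all [|C i j|] dominates each row sum, so each further factor [C] multiplies the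
    entrywise bound by at most this constant. *)
Lemma mxpow_entry_bound (R : realType) (n : nat) (C : 'M[R]_n) :
  forall k i j, `|(C ^+ k) i j| <= (\sum_i \sum_j `|C i j|) ^+ k.
Proof.
elim=> [|k IHk] i j.
  by rewrite !expr0 mxE; case: eqP => _; rewrite ?normr1 ?normr0.
rewrite !exprS mxE; apply: le_trans (ler_norm_sum _ _ _) _.
apply: le_trans (_ : \sum_l `|C i l| * (\sum_i \sum_j `|C i j|) ^+ k <= _).
  by apply: ler_sum => l _; rewrite normrM ler_wpM2l.
rewrite -mulr_suml ler_wpM2r//.
  by rewrite exprn_ge0// sumr_ge0// => a _; rewrite sumr_ge0.
by rewrite [leRHS](bigD1 i)//= lerDl sumr_ge0// => a _; rewrite sumr_ge0.
Qed.

Lemma expmx_series_cvg (R : realType) (n : nat) (C : 'M[R]_n) (t : R) :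
  let E := \matrix_(i, j) limn (pseries (fun k => (k`!%:R)^-1 * (C ^+ k) i j) t) in
  series (fun k => (k`!%:R)^-1 *: (t *: C) ^+ k) @ \oo --> E.
Proof.
move=> E; apply: cvg_mx_entries => i j; rewrite mxE.
rewrite (_ : (fun _ => _) = pseries (fun k => (k`!%:R)^-1 * (C ^+ k) i j) t).
  apply: (@cvg_pseries_fact _ _ 1 (\sum_i \sum_j `|C i j|)) => k.
  by rewrite mul1r mxpow_entry_bound.
have powZ k : (t *: C) ^+ k = t ^+ k *: C ^+ k.
  elim: k => [|k IHk]; first by rewrite !expr0 scale1r.
  by rewrite !exprS IHk -[LHS]/(_ *m _) -scalemxAl -scalemxAr scalerA.
apply/funext => N; rewrite /pseries /series/= summxE.
by under [LHS]eq_bigr do rewrite mxE powZ mxE [_ ^+ _ * _]mulrC mulrA.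
Qed.

Lemma expmxE (R : realType) (n : nat) (C : 'M[R]_n) (t : R) i j :
  expmx (t *: C) i j = limn (pseries (fun k => (k`!%:R)^-1 * (C ^+ k) i j) t).
Proof. by rewrite /expmx (cvg_lim _ (expmx_series_cvg R n C t))// mxE. Qed.

(** Each entry is a power series in [t]; the shifted coefficients come from C^(k+1) = C C^k, and the
    left factor [C], a finite linear combination, passes through the limit. *)
Lemma is_derive_expmx (R : realType) (n : nat) (C : 'M[R]_n) (t : R) :
  is_derive t 1 (fun x => expmx (x *: C)) (C *m expmx (t *: C)).
Proof.
apply/is_derive_mxP => i j.
pose K := \sum_i \sum_j `|C i j|.
have bK i' j' k : `|(C ^+ k) i' j'| <= 1 * K ^+ k.
  by rewrite mul1r mxpow_entry_bound.
rewrite (_ : (fun _ => _) =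
  fun x => limn (pseries (fun k => (k`!%:R)^-1 * (C ^+ k) i j) x)); last first.
  by apply/funext => x; rewrite expmxE.
rewrite (_ : (C *m _) i j =
  limn (pseries (fun k => (k`!%:R)^-1 * (C ^+ k.+1) i j) t)).
  exact: is_derive_pseries_fact (bK i j).
apply/esym/cvg_lim => //.
rewrite mxE (_ : pseries _ _ = fun N =>
    \sum_l C i l * pseries (fun k => (k`!%:R)^-1 * (C ^+ k) l j) t N).
  apply: cvg_big => [|l _]; first exact: add_continuous.
  apply: cvgMr; rewrite expmxE.
  exact: cvg_pseries_fact (bK l j).
apply/funext => N; rewrite /pseries /series/=.
under [RHS]eq_bigr do rewrite mulr_sumr.
rewrite exchange_big/=; apply: eq_bigr => k _.
rewrite exprS mxE mulr_sumr mulr_suml; apply: eq_bigr => l _.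
by rewrite [_^-1 * (_ * _)]mulrCA !mulrA.
Qed.

Lemma expmx0 (R : realType) (n : nat) : expmx (0 : 'M[R]_n) = 1%:M.
Proof.
suff H : series (fun k => (k`!%:R)^-1 *: (0 : 'M[R]_n) ^+ k) @ \oo --> (1%:M : 'M[R]_n).
  by rewrite /expmx (cvg_lim _ H).
apply: cvg_near_cst; near=> N.
(* The empty partial sum is 0; from [N = 1] on, only the term [k = 0] survives, and it is the
   identity. *)
have N0 : (0 < N)%N by near: N; exact: nbhs_infty_gt.
rewrite /series/= -(prednK N0) big_nat_recl//= expr0 fact0 invr1 scale1r.
rewrite big1 ?addr0// => k _; rewrite exprS -[_ * _]/(0 *m _) mul0mx scaler0//.
Unshelve. all: by end_near. Qed.

(** * The curves B e^{tC} in SL(n) *)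

Lemma det_expmx (R : realType) (n : nat) (C : 'M[R]_n) (t : R) :
  \tr C = 0 -> \det (expmx (t *: C)) = 1.
Proof.
move=> trC; rewrite -[RHS](det1 R n) -(expmx0 R n) -(scale0r C).
apply: (@is_derive_0_is_cst R (fun x => \det (expmx (x *: C)))) => x.
apply: is_derive_eq; first exact: is_derive_det (is_derive_expmx R n C x).
(* With E = e^{xC}, the derivative of det E is tr(C E adj E) = det E tr C = 0. *)
by rewrite -mulmxA mul_mx_adj mul_mx_scalar linearZ/= trC /GRing.scale/= mulr0.
Qed.

Lemma is_derive_mul_expmx (R : realType) (n : nat) (B C : 'M[R]_n) (t : R) :
  is_derive t 1 (fun x => B *m expmx (x *: C)) (B *m C *m expmx (t *: C)).
Proof.
have dB : is_derive t (1 : R) (fun=> B) 0 by exact: is_derive_cst.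
have := is_derive_mulmx _ _ _ _ _ _ _ _ _ dB (is_derive_expmx R n C t).
by rewrite mul0mx add0r mulmxA.
Qed.

Lemma derive1n_mul_expmx (R : realType) (n : nat) (B C : 'M[R]_n) (k : nat) :
  derive1n k (fun t => B *m expmx (t *: C)) =
  (fun t => B *m C ^+ k *m expmx (t *: C)).
Proof.
elim: k => [|k IHk]; first by rewrite derive1n0 expr0 -[1]/(1%:M) mulmx1.
rewrite derive1nS IHk; apply/funext => t; rewrite derive1E.
have [_ ->] := is_derive_mul_expmx R n (B *m C ^+ k) C t.
by rewrite exprSr -[_ * C]/(_ *m C) !mulmxA.
Qed.

Lemma smooth_SL_curve_expmx (R : realType) (n : nat) (B C : 'M[R]_n) :
  SL B -> sl C -> smooth_SL_curve (fun t => B *m expmx (t *: C)).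
Proof.
move=> detB trC; split=> [t|k t].
  by rewrite /SL/= det_mulmx detB det_expmx// mulr1.
rewrite derive1n_mul_expmx.
by have [] := is_derive_mul_expmx R n (B *m C ^+ k) C t.
Qed.

(** * Tangent spaces of SL(n) and the geodesic criterion *)

Lemma SL_tangent_mul (R : realType) (n : nat) (P Y : 'M[R]_n) :
  SL P -> sl Y -> SL_tangent P (P *m Y).
Proof.
move=> hP hY; exists (fun t => P *m expmx (t *: Y)); split.
- exact: smooth_SL_curve_expmx.
- by rewrite scale0r expmx0 mulmx1.
- rewrite derive1E; have [_ ->] := is_derive_mul_expmx R n P Y 0.
  by rewrite scale0r expmx0 mulmx1.
Qed.

(** The determinant is constant along the curve, so Jacobi's formula gives 0. On SL(n) the adjugate
    is the inverse, hence X P^{-1} is trace-free. *)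
Lemma SL_tangent_adj (R : realType) (n : nat) (P X : 'M[R]_n) :
  SL_tangent P X -> \tr (X *m \adj P) = 0.
Proof.
move=> [g [[gSL gdiff] <- <-]].
have dg : is_derive (0 : R) 1 g ((g^`())%classic 0).
  by split; [exact: gdiff 0%N 0|rewrite derive1E].
have [_ <-] := is_derive_det R n g 0 _ dg.
rewrite (_ : (fun _ => _) = cst 1) ?derive_cst//.
by apply/funext => x; exact: gSL.
Qed.

(** Pairing with a matrix unit reads off an entry. The trace-free matrices E_ij with i and j
    distinct kill the off-diagonal entries, and E_ii - E_00 equates the diagonal ones. *)
Lemma is_scalar_mx_orth (R : realType) (n : nat) (M : 'M[R]_n) :
  (forall Y, sl Y -> \tr (M *m Y^T) = 0) -> is_scalar_mx M.
Proof.
case: n M => [|n] M orthM; first by apply/is_scalar_mxP; exists 0; apply/matrixP => -[].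
have trMdelta i j : \tr (M *m (delta_mx i j)^T) = M i j.
  rewrite trmx_delta mxtrace_mulC; rewrite /mxtrace (bigD1 j)//= big1 => [|k kj].
    rewrite addr0 mxE (bigD1 i)//= big1 => [|l li].
      by rewrite addr0 mxE !eqxx mul1r.
    by rewrite mxE (negbTE li) andbF mul0r.
  by rewrite mxE big1// => l _; rewrite mxE (negbTE kj) mul0r.
have trdelta i j : \tr (delta_mx i j : 'M[R]_n.+1) = (i == j)%:R.
  rewrite /mxtrace (bigD1 i)//= big1 ?addr0 => [|k ki]; first by rewrite mxE eqxx.
  by rewrite mxE (negbTE ki).
apply/is_scalar_mxP; exists (M 0 0); apply/matrixP => i j; rewrite mxE.
case: eqVneq => [<-|ij]; rewrite ?mulr1n ?mulr0n.
  apply/eqP; rewrite -subr_eq0 -!trMdelta -linearB/= -mulmxBr -linearB/=.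
  by rewrite orthM// /sl/= linearB/= !trdelta !eqxx subrr.
by rewrite -trMdelta orthM// /sl/= trdelta (negbTE ij).
Qed.

(** Tangent vectors A Y with Y trace-free turn normality of A'' into orthogonality of A^T A'' to
    sl(n). Conversely, A^T A'' = l I commutes to A'' A^T = l I, so the pairing of A'' with X is l
    tr(X adj A) = 0. *)
Lemma SL_geodesicP (R : realType) (n : nat) (A : R -> 'M[R]_n) :
  smooth_SL_curve A ->
  SL_geodesic A <->
  forall t, is_scalar_mx ((A t)^T *m (A^`(2))%classic t).
Proof.
move=> smA; have [detA _] := smA; split=> [[_ geo] t|scal].
  apply: is_scalar_mx_orth => Y trY.
  rewrite -mulmxA mxtrace_mulC -mulmxA -trmx_mul.
  exact: geo (SL_tangent_mul R n _ _ (detA t) trY).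
split=> // t X /SL_tangent_adj trX.
have /is_scalar_mxP[l lE] := scal t.
have uA : (A t)^T \in unitmx by rewrite unitmx_tr unitmxE (detA t) unitr1.
have XE : X = X *m \adj (A t) *m A t.
  by rewrite -mulmxA mul_adj_mx (detA t : \det (A t) = 1) mulmx1.
have GA : (A^`(2))%classic t *m (A t)^T = l%:M.
  by rewrite -[(A^`(2))%classic t](mulKmx uA) lE scalar_mxC mulmxKV.
rewrite /hs_inner XE trmx_mul mulmxA GA mul_scalar_mx linearZ/= mxtrace_tr trX.
by rewrite /GRing.scale/= mulr0.
Qed.

(** * Scalar, skew and Gram matrices *)

Lemma tr_mul_trmx_gt0 (R : realType) (m n : nat) (M : 'M[R]_(m, n)) :
  M != 0 -> 0 < \tr (M *m M^T).
Proof.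
move=> M0.
have trE : \tr (M *m M^T) = \sum_i \sum_j M i j ^+ 2.
  apply: eq_bigr => i _; rewrite mxE; apply: eq_bigr => j _.
  by rewrite mxE expr2.
have trge0 i : true -> 0 <= \sum_j M i j ^+ 2.
  by move=> _; apply: sumr_ge0 => j _; exact: sqr_ge0.
rewrite lt_neqAle eq_sym trE sumr_ge0// andbT.
apply: contra M0 => /eqP s0; apply/eqP/matrixP => i j; rewrite mxE.
have := psumr_eq0P trge0 s0 (i := i) isT.
move=> /(psumr_eq0P (fun k _ => sqr_ge0 (M i k)))/(_ j isT)/eqP.
by rewrite sqrf_eq0 => /eqP.
Qed.

Lemma is_derive_scalar_mx (R : realType) (n : nat) (M : R -> 'M[R]_n) (t : R)
    (D : 'M[R]_n) :
  (forall x, is_scalar_mx (M x)) -> is_derive t 1 M D -> is_scalar_mx D.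
Proof.
case: n M D => [|n] M D scal /is_derive_mxP dM.
  by apply/is_scalar_mxP; exists 0; apply/matrixP => -[].
apply/is_scalar_mxP; exists (D 0 0); apply/matrixP => i j; rewrite mxE.
have [_ <-] := dM i j.
case: eqVneq => [<-|ij]; rewrite ?mulr1n ?mulr0n.
  have [_ <-] := dM 0 0; congr ('D_1 _ t); apply/funext => x.
  by have /is_scalar_mxP[a ->] := scal x; rewrite !mxE !eqxx.
rewrite (_ : (fun _ => _) = cst 0) ?derive_cst//; apply/funext => x.
by have /is_scalar_mxP[a ->] := scal x; rewrite mxE (negbTE ij).
Qed.

Lemma scalar_mx_inj (R : realType) (n : nat) (a b : R) :
  (0 < n)%N -> a%:M = b%:M :> 'M[R]_n -> a = b.
Proof.
by move=> n0 /matrixP/(_ (Ordinal n0) (Ordinal n0)); rewrite !mxE eqxx !mulr1n.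
Qed.

Lemma invmx_gram (R : realType) (n : nat) (B C : 'M[R]_n) (k : R) : SL B ->
  C = k *: invmx (B^T *m B) <-> B^T *m B *m C = k%:M.
Proof.
move=> detB.
have uP : B^T *m B \in unitmx.
  by rewrite unitmxE det_mulmx det_tr (detB : \det B = 1) mulr1 unitr1.
split=> [->|PC]; first by rewrite -scalemxAr mulmxV// scalemx1.
by rewrite -[C](mulKmx uP) PC -mul_mx_scalar.
Qed.

(** The derivative of E^T E is E^T (C^T + C) E = 0, and E^T E = I at time 0. *)
Lemma expmx_skew_orth (R : realType) (n : nat) (C : 'M[R]_n) (t : R) :
  so C -> (expmx (t *: C))^T *m expmx (t *: C) = 1%:M.
Proof.
move=> skewC.
pose M (x : R) := (expmx (x *: C))^T *m expmx (x *: C).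
suff dM (x : R) : is_derive x 1 M 0.
  rewrite -[LHS]/(M t) (is_derive_0_mx_cst R n n M t 0 dM).
  by rewrite /M scale0r expmx0 trmx1 mulmx1.
have dE := is_derive_expmx R n C x.
have := is_derive_mulmx _ _ _ _ _ _ _ _ _ (is_derive_trmx _ _ _ _ _ _ dE) dE.
by rewrite trmx_mul (skewC : C^T = - C) mulmxN mulNmx mulmxA addNr.
Qed.

(** Differentiating E^T E at 0 shows that C^T + C is a scalar matrix; its trace vanishes, so the
    scalar is 0 because [n] is positive. *)
Lemma conformal_expmx_skew (R : realType) (n : nat) (C : 'M[R]_n) :
  (0 < n)%N -> sl C ->
  (forall t : R, is_scalar_mx ((expmx (t *: C))^T *m expmx (t *: C))) -> so C.
Proof.
move=> n0 trC scal; have dE := is_derive_expmx R n C 0.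
have := is_derive_mulmx _ _ _ _ _ _ _ _ _ (is_derive_trmx _ _ _ _ _ _ dE) dE.
rewrite scale0r expmx0 trmx_mul trmx1 mul1mx !mulmx1 mul1mx.
move=> /(is_derive_scalar_mx _ _ _ _ _ scal)/is_scalar_mxP[a aE].
have : \tr (C^T + C) = a *+ n by rewrite aE mxtrace_scalar.
rewrite linearD/= mxtrace_tr (trC : \tr C = 0) addr0 => /esym/eqP.
rewrite mulrn_eq0 -leqn0 leqNgt n0/= => /eqP a0.
by apply/eqP; rewrite -addr_eq0 aE a0 raddf0.
Qed.

(** For odd [n], det C = det C^T = det(-C) = - det C. *)
Lemma skew_unitmx_even (R : realType) (n : nat) (C : 'M[R]_n) :
  so C -> C \in unitmx -> ~~ odd n.
Proof.
move=> skewC; rewrite unitmxE unitfE; apply: contra => oddn.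
have : \det C = - \det C.
  rewrite -{1}det_tr (skewC : C^T = - C) -scaleN1r detZ -signr_odd oddn.
  by rewrite expr1 mulN1r.
by move/eqP; rewrite -subr_eq0 opprK -mulr2n mulrn_eq0.
Qed.

(** Take traces in C C^T = - C^2 = - k B^{-1} B^{-T}: both tr(C C^T) and tr(B^{-1} B^{-T}) are
    squared norms of nonzero matrices. *)
Lemma skew_sqr_gram_lt0 (R : realType) (n : nat) (B C : 'M[R]_n) (k : R) :
  (0 < n)%N -> SL B -> so C -> k != 0 ->
  C *m C = k *: invmx (B^T *m B) -> k < 0.
Proof.
move=> n0 detB skewC k0 CC.
have uB : B \in unitmx by rewrite unitmxE (detB : \det B = 1) unitr1.
have invP : invmx (B^T *m B) = invmx B *m (invmx B)^T.
  have uP : B^T *m B \in unitmx by rewrite unitmx_mul unitmx_tr uB.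
  rewrite -[RHS](mulKmx uP) !mulmxA mulmxK// -mulmxA -trmx_mul mulVmx//.
  by rewrite trmx1 mulmx1.
have CCT : C *m C^T = - k *: invmx (B^T *m B).
  by rewrite (skewC : C^T = - C) mulmxN CC scaleNr.
have C0 : C != 0.
  apply: contra k0 => /eqP C0; apply/eqP/(scalar_mx_inj R n) => //.
  have [/(_ CC) <- _] := invmx_gram R n B (C *m C) k detB.
  by rewrite C0 !mulmx0 raddf0.
have B0 : invmx B != 0.
  apply: contra_neq (oner_neq0 R) => B0; apply: (scalar_mx_inj R n) => //.
  by rewrite -(mulVmx uB) B0 mul0mx raddf0.
have := tr_mul_trmx_gt0 R n n C C0.
rewrite CCT invP linearZ/= pmulr_lgt0 ?oppr_gt0//.
exact: tr_mul_trmx_gt0.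
Qed.

Theorem theorem4p4 (R : realType) (n : nat) (hn : (2 <= n)%N)
    (B C : 'M[R]_n) (hB : SL B) (hC : sl C) :
  SL_geodesic (fun t : R => B *m expmx (t *: C)) <->
  exactly_one
    (C *m C = 0)
    [/\ ~~ odd n, so C
      & exists kappa : R, kappa < 0 /\ C *m C = kappa *: invmx (B^T *m B)].
Proof.
have n0 : (0 < n)%N by exact: ltnW.
have kP k := invmx_gram R n B (C *m C) k hB.
have accE t : (B *m expmx (t *: C))^T *m
    (derive1n 2 (fun t => B *m expmx (t *: C))) t =
    (expmx (t *: C))^T *m (B^T *m B *m (C *m C)) *m expmx (t *: C).
  by rewrite derive1n_mul_expmx trmx_mul !mulmxA.
rewrite SL_geodesicP; last exact: smooth_SL_curve_expmx.
split=> [scal|].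
- have /is_scalar_mxP[k] := scal 0.
  rewrite accE scale0r expmx0 trmx1 mulmx1 mul1mx => PCC.
  have CC := (kP k).2 PCC.
  have [k0|k0] := eqVneq k 0.
    (* Case (ii) is excluded here: its constant [l] would have to equal [k = 0]. *)
    left; split=> [|[_ _ [l [l0 /kP]]]]; first by rewrite CC k0 scale0r.
    rewrite PCC k0 => /(scalar_mx_inj _ _ _ _ n0) l0'.
    by rewrite -l0' ltxx in l0.
  right; split.
    move=> CC0; move: k0; apply/negP; rewrite negbK; apply/eqP.
    by apply: (scalar_mx_inj R n) => //; rewrite -PCC CC0 mulmx0 raddf0.
  have skewC : so C.
    apply: conformal_expmx_skew => // t.
    have /is_scalar_mxP[l] := scal t.
    rewrite accE PCC mul_mx_scalar -scalemxAl => lE.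
    (* At time [t] the criterion reads k E^T E = l I; divide by [k]. *)
    apply/is_scalar_mxP; exists (k^-1 * l).
    by rewrite -scale_scalar_mx -lE scalerA mulVf ?scale1r.
  have k_lt0 := skew_sqr_gram_lt0 R n B C k n0 hB skewC k0 CC.
  split=> //; last by exists k.
  apply: skew_unitmx_even skewC _.
  have : B^T *m B *m (C *m C) \in unitmx.
    by rewrite PCC unitmxE det_scalar unitrX// unitfE.
  by rewrite !unitmx_mul => /andP[_ /andP[]].
- move=> [[CC _]|[_ [_ skewC [k [_ /kP PCC]]]]] t; rewrite accE.
    by rewrite CC !mulmx0 mul0mx; apply/is_scalar_mxP; exists 0; rewrite raddf0.
  (* Orthogonality of E turns E^T (k I) E into k I. *)
  rewrite PCC mul_mx_scalar -scalemxAl expmx_skew_orth//.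
  by apply/is_scalar_mxP; exists k; rewrite scalemx1.
Qed.
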